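(* Let $\mathcal X$ be a measurable space, let $\Phi=\{g_1,\dots,g_d\}$ be a finite nonempty set of real-valued measurable functions on $\mathcal X$, let $\mathcal P$ be the hypothesis generated by $\Phi$, and let $\bar\mu$ be a (nonnegative) measure on $\mathcal X$. Define $\mathcal P_{\bar\mu}=\{\mu\in\mathcal P:\mu\ll\bar\mu\}$, which is the hypothesis generated by $\Phi_{\bar\mu}=\Phi\cup\{\mathbf 1_A : A\subset\mathcal X \text{ measurable},\ \bar\mu(A)=0\}$. Let $\mathcal L^{\Phi_{\bar\mu}}$ be the set of real-valued measurable $f$ on $\mathcal X$ with $\int|f|\,d\mu<\infty$ for all $\mu\in\mathcal P_{\bar\mu}$. Then: (a) A function $f\in\mathcal L^{\Phi_{\bar\mu}}$ satisfies $\int_{\mathcal X}f\,d\mu\le 0$ for all $\mu\in\mathcal P_{\bar\mu}$ if and only if $f\le\sum_{i=1}^d\pi_i g_i$, $\mathcal P_{\bar\mu}$-q.s., for some $\pi\in\mathbb R^d_+$. In particular, the e-variables for $\mathcal P_{\bar\mu}$ are precisely the $[0,\infty]$-valued measurable functions which are $\mathcal P_{\bar\mu}$-q.s. dominated by $1+\sum_{i=1}^d\pi_i g_i$ for some $\pi\in\mathbb R^d_+$. (b) Every admissible e-variable for $\mathcal P_{\bar\mu}$ is $\mathcal P_{\bar\mu}$-q.s. equal to $1+\sum_{i=1}^d\pi_i g_i$ for some $\pi$ in the set $\{\pi\in\mathbb R^d_+: 1+\sum_{i=1}^d\pi_i g_i\ge 0\ \ \mathcal P_{\bar\mu}\text{-q.s.}\}$.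 Conversely, every $[0,\infty]$-valued measurable function that is $\mathcal P_{\bar\mu}$-q.s. equal to such an expression is an admissible e-variable for $\mathcal P_{\bar\mu}$, provided the following holds: if $g,g'\in\mathrm{cone}(\Phi_{\bar\mu})$ and $g\le g'$, $\mathcal P_{\bar\mu}$-q.s., then $g=g'$, $\mathcal P_{\bar\mu}$-q.s.
   Context: The hypothesis generated by a nonempty set $\Psi$ of real-valued measurable functions on $\mathcal X$ is the (possibly empty) set of all probability measures $\mu$ on $\mathcal X$ such that $\int|f|\,d\mu<\infty$ and $\int f\,d\mu\le 0$ for all $f\in\Psi$. For a set $\mathcal Q$ of probability measures on $\mathcal X$: a measurable set $A$ is $\mathcal Q$-negligible if $\mu(A)=0$ for all $\mu\in\mathcal Q$; a pointwise property holds $\mathcal Q$-quasi-surely ($\mathcal Q$-q.s.) if the set where it fails is $\mathcal Q$-negligible. An e-variable for $\mathcal Q$ is a measurable $h:\mathcal X\to[0,\infty]$ with $\int_{\mathcal X} h\,d\mu\le 1$ for all $\mu\in\mathcal Q$; it is admissible if whenever another e-variable $h'$ for $\mathcal Q$ satisfies $h'\ge h$, $\mathcal Q$-q.s., one has $h'=h$, $\mathcal Q$-q.s. $\mathrm{cone}(\Psi)$ is the set of finite linear combinations of elements of $\Psi$ with nonnegative coefficients. $\mathbb R^d_+=[0,\infty)^d$. *)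

(* Defs.v *)
From HB Require Import structures.
From mathcomp Require Import all_boot all_order all_algebra.
From mathcomp Require Import all_classical all_reals all_analysis measurable_realfun.

Set Implicit Arguments.
Unset Strict Implicit.
Unset Printing Implicit Defensive.

Import Order.TTheory GRing.Theory Num.Theory.

Local Open Scope classical_set_scope.
Local Open Scope ring_scope.

Section hypotheses.
Context {R : realType} {d : measure_display} {T : measurableType d}.
Implicit Types (Psi : set (T -> R)) (Q : set (probability T R)).

(* [integrable] also asks for measurability, which adds nothing when the
   elements of Psi are measurable. *)
Definition hypothesis Psi : set (probability T R) :=
  [set mu | forall f, Psi f ->
     mu.-integrable [set: T] (EFin \o f) /\
     (\int[mu]_x (f x)%:E <= 0)%E].

Definition dominated_part Q (nu : {measure set T -> \bar R}) :
    set (probability T R) :=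
  Q `&` [set mu | mu `<< nu].

Definition with_null_indicators Psi (nu : {measure set T -> \bar R}) :
    set (T -> R) :=
  Psi `|` [set f | exists A, [/\ measurable A, nu A = 0%E & f = \1_A]].

Definition Q_negligible Q (A : set T) : Prop :=
  measurable A /\ forall mu, Q mu -> mu A = 0%E.

(* The set of failure is required to be measurable, and not just to be included
   in null sets that may depend on mu. *)
Definition quasi_surely Q (p : T -> Prop) : Prop :=
  Q_negligible Q [set x | ~ p x].

Definition is_evariable Q (h : T -> \bar R) : Prop :=
  [/\ measurable_fun [set: T] h, (forall x, (0 <= h x)%E) &
      forall mu, Q mu -> (\int[mu]_x h x <= 1)%E].

Definition admissible Q (h : T -> \bar R) : Prop :=
  is_evariable Q h /\
  forall h', is_evariable Q h' ->
    quasi_surely Q (fun x => (h x <= h' x)%E) ->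
    quasi_surely Q (fun x => h' x = h x).

Definition cone Psi : set (T -> R) :=
  [set f | exists (n : nat) (c : 'I_n -> R) (h : 'I_n -> T -> R),
     [/\ forall i, 0 <= c i, forall i, Psi (h i) &
         f = (fun x => \sum_(i < n) c i * h i x)]].

Definition Q_integrable Q : set (T -> R) :=
  [set f | measurable_fun [set: T] f /\
     forall mu, Q mu -> mu.-integrable [set: T] (EFin \o f)].

Definition lincomb (n : nat) (g : 'I_n -> T -> R) (w : 'rV[R]_n) (x : T) : R :=
  \sum_(i < n) w 0 i * g i x.

End hypotheses.

Definition nonneg_orthant (R : realType) (n : nat) : set 'rV[R]_n :=
  [set w | forall i, 0 <= w 0 i].

(* Main.v *)
(* The key point is a Farkas lemma for a convex cone C that need not be closed:
   if every k in C lies below (for the order of C) some k' in C satisfying the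
   constraints G_i <= 0, and F <= 0 on the part of C where all G_i <= 0, then F
   is bounded on C by a nonnegative combination of the G_i.  When some k in C
   satisfies all constraints strictly, the multipliers are found one constraint
   at a time.  Otherwise some nontrivial combination of the G_i with nonnegative
   coefficients is nonnegative on C; the assumption on k' forces it to vanish on
   C, so that a constraint G_j with positive coefficient is an equality and one
   inducts on C and [G_j = 0].

   This is applied to the cone of moments (int g_i dm, int f dm) of the finite
   measures m that lie below a multiple of an element of the hypothesis.  Since
   m may be any restriction of any such element, the multipliers obtained are
   common to the whole hypothesis, and no exhaustion or compactness argument is
   needed to pass from almost sure to quasi-sure inequalities. *)
Require Import Defs.
From HB Require Import structures.
From mathcomp Require Import all_boot all_order all_algebra.
From mathcomp Require Import all_classical all_reals all_analysis measurable_realfun.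
From mathcomp Require Import lra ring.

Set Implicit Arguments.
Unset Strict Implicit.
Unset Printing Implicit Defensive.

Import Order.TTheory GRing.Theory Num.Theory.

Local Open Scope classical_set_scope.
Local Open Scope ring_scope.

(** * Theorems of the alternative on convex cones *)

Section farkas.
Context {R : realType} {V : lmodType R} {I : finType}.
Implicit Types (C : set V) (F : V -> R) (G : I -> V -> R) (A : {set I}).

Definition convex_cone C : Prop :=
  forall a b u v, 0 <= a -> 0 <= b -> C u -> C v -> C (a *: u + b *: v).

Lemma scalar_comb F a b u v : scalar F ->
  F (a *: u + b *: v) = a * F u + b * F v.
Proof.
move=> Fl; have F0 : F 0 = 0.
  by have := Fl 1 0 0; rewrite scaler0 addr0 mul1r; lra.
by rewrite Fl -[b *: v]addr0 Fl F0 addr0.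
Qed.

Lemma scalarB F u v : scalar F -> F (u - v) = F u - F v.
Proof.
move=> Fl; have := scalar_comb 1 (-1) u v Fl.
by rewrite scale1r scaleN1r mul1r mulN1r.
Qed.

Lemma scalar_sum G A (p : I -> R) : (forall i, scalar (G i)) ->
  scalar (fun k => \sum_(i in A) p i * G i k).
Proof.
move=> Gl a u v; rewrite mulr_sumr -big_split; apply: eq_bigr => i _ /=.
by rewrite Gl; ring.
Qed.

Lemma sum_updated A j c (p : I -> R) (x : I -> R) : j \in A ->
  \sum_(i in A) (if i == j then c else p i) * x i =
  c * x j + \sum_(i in A :\ j) p i * x i.
Proof.
move=> jA; rewrite (big_setD1 _ jA) eqxx; congr (_ + _).
by apply: eq_bigr => i; rewrite !inE => /andP[/negbTE -> _].
Qed.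

(** A point with [G < 0] and one with [0 < G] have a positive combination on which [G] vanishes and
    hence [F <= 0]. So each ratio [F / G] on the positive side lies below each ratio on the negative
    side, and any [c] between the two families works. The points [k1] and [k2] make both families
    nonempty. *)
Lemma equality_multiplier C (G F : V -> R) k1 k2 :
  convex_cone C -> scalar G -> scalar F ->
  C k1 -> G k1 < 0 -> C k2 -> 0 < G k2 ->
  (forall k, C k -> G k = 0 -> F k <= 0) ->
  exists c, forall k, C k -> F k <= c * G k.
Proof.
move=> CC Gl Fl Ck1 Gk1 Ck2 Gk2 imp.
have slope u v : C u -> C v -> G u < 0 -> 0 < G v -> F v / G v <= F u / G u.
  move=> Cu Cv Gu Gv.
  (* The two weights are chosen so that [G] cancels. *)
  have := imp (G v *: u + (- G u) *: v).
  rewrite !scalar_comb// => /(_ _ _)H.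
  have {}H : G v * F u + - G u * F v <= 0.
    by apply: H; [apply: CC => //; lra|ring].
  by rewrite ler_pdivrMr// mulrAC ler_ndivlMr//; lra.
pose S := [set F k / G k | k in [set k | C k /\ 0 < G k]].
have ubS u : C u -> G u < 0 -> ubound S (F u / G u).
  by move=> Cu Gu _ [k [Ck Gk] <-]; exact: slope.
have supS : has_sup S.
  by split; [exists (F k2 / G k2), k2|exists (F k1 / G k1); exact: ubS].
exists (sup S) => k Ck; have [Gk|Gk|Gk] := ltrgtP (G k) 0.
- rewrite -ler_ndivlMr//; apply: ge_sup; [exact: supS.1|exact: ubS].
- rewrite -ler_pdivrMr//; apply: ub_le_sup; [exact: supS.2|by exists k].
- by rewrite Gk mulr0; exact: imp.
Qed.

(** If the multiplier found for the constraint [G = 0] is negative, then [F <= c * G <= 0] wherever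
    [0 < G], while [F <= 0] wherever [G <= 0]; so 0 serves as multiplier. *)
Lemma inequality_multiplier C (G F : V -> R) k1 :
  convex_cone C -> scalar G -> scalar F -> C k1 -> G k1 < 0 ->
  (forall k, C k -> G k <= 0 -> F k <= 0) ->
  exists2 c, 0 <= c & forall k, C k -> F k <= c * G k.
Proof.
move=> CC Gl Fl Ck1 Gk1 imp.
have [[k2 [Ck2 Gk2]]|npos] := pselect (exists k, C k /\ 0 < G k); last first.
  exists 0 => // k Ck; rewrite mul0r; apply: imp => //.
  by rewrite leNgt; apply/negP => Gk; apply: npos; exists k.
have [|c Hc] := equality_multiplier CC Gl Fl Ck1 Gk1 Ck2 Gk2.
  by move=> k Ck Gk; apply: imp; rewrite ?Gk.
have [c0|c0] := leP 0 c; first by exists c.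
exists 0 => // k Ck; rewrite mul0r; have [Gk|Gk] := leP (G k) 0.
  exact: imp.
by apply: (le_trans (Hc k Ck)); rewrite nmulr_rle0// ltW.
Qed.

(** Induction on the number of constraints: one constraint [j] is moved into the cone, which still
    contains the strict point [k1]. Once multipliers for the others are known on the smaller cone,
    [F] minus their combination satisfies the hypotheses of the one-constraint case on the whole of
    [C]. *)
Lemma slater_multipliers G A C F k1 :
  convex_cone C -> (forall i, scalar (G i)) -> scalar F ->
  C k1 -> (forall i, i \in A -> G i k1 < 0) ->
  (forall k, C k -> (forall i, i \in A -> G i k <= 0) -> F k <= 0) ->
  exists2 p : I -> R, forall i, 0 <= p i &
    forall k, C k -> F k <= \sum_(i in A) p i * G i k.
Proof.
move: {2}#|A| (erefl #|A|) => n; elim: n A C F => [|n IH] A C F cA CC Gl Fl Ck1 Gk1 imp.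
  have A0 : A = finset.set0 by apply/eqP; rewrite -cards_eq0 cA.
  exists (fun=> 0) => // k Ck; rewrite A0 big_set0; apply: imp => // i.
  by rewrite A0 inE.
have [j jA] : exists j, j \in A by apply/set0Pn; rewrite -cards_eq0 cA.
pose C' := C `&` [set k | G j k <= 0].
have CC' : convex_cone C'.
  move=> a b u v a0 b0 [Cu Gu] [Cv Gv]; split; first exact: CC.
  by rewrite /= scalar_comb//; rewrite /= in Gu Gv; nra.
have [||||p p0 Hp] := IH (A :\ j) C' F _ CC' Gl Fl.
- by move: cA; rewrite (cardsD1 j) jA => -[].
- by split => //; apply: ltW; exact: Gk1.
- by move=> i; rewrite !inE => /andP[_]; exact: Gk1.
- move=> k [Ck Gk] H; apply: imp => // i iA.
  by have [->//|ij] := eqVneq i j; apply: H; rewrite !inE ij.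
have Fl' : scalar (fun k => F k - \sum_(i in A :\ j) p i * G i k).
  move=> a u v; rewrite Fl (scalar_sum _ _ Gl) /=; ring.
have [||c c0 Hc] := inequality_multiplier CC (Gl j) Fl' Ck1.
- exact: Gk1.
- by move=> k Ck Gk; rewrite subr_le0; exact: Hp.
exists (fun i => if i == j then c else p i) => [i|k Ck]; first by case: ifP.
by rewrite sum_updated// -lerBlDr; exact: Hc.
Qed.

(** Suppose that a strict point exists for all constraints but [j], and none for all of them. Then
    [- G j <= 0] wherever the others are at most 0, and the strict case applied to [- G j] yields a
    combination in which [j] has coefficient 1. *)
Lemma gordan_alternative G A C k0 :
  convex_cone C -> (forall i, scalar (G i)) -> C k0 ->
  (exists2 k, C k & forall i, i \in A -> G i k < 0) \/
  (exists p : I -> R, [/\ forall i, 0 <= p i, exists2 j, j \in A & 0 < p j &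
    forall k, C k -> 0 <= \sum_(i in A) p i * G i k]).
Proof.
move=> CC Gl Ck0.
move: {2}#|A| (erefl #|A|) => n; elim: n A => [|n IH] A cA.
  have A0 : A = finset.set0 by apply/eqP; rewrite -cards_eq0 cA.
  by left; exists k0 => // i; rewrite A0 inE.
have [j jA] : exists j, j \in A by apply/set0Pn; rewrite -cards_eq0 cA.
have inD i : i \in A -> i != j -> i \in A :\ j by move=> iA ij; rewrite !inE ij.
case: (IH (A :\ j)); first by move: cA; rewrite (cardsD1 j) jA => -[].
  move=> [k1 Ck1 Gk1].
  have [|none] := pselect (exists2 k, C k & forall i, i \in A -> G i k < 0).
    by left.
  right.
  have [|k Ck Gk|p p0 Hp] :=
    slater_multipliers (F := fun k => - G j k) CC Gl _ Ck1 Gk1.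
    by move=> a u v; rewrite Gl /=; ring.
    rewrite oppr_le0 leNgt; apply/negP => Gjk; apply: none.
    (* A step towards [k1] makes the other constraints strict. This [e] is small enough for it to
       change [G j] by less than half of [- G j k], so [G j] stays negative. *)
    pose e := - G j k / (2 * (`|G j k1| + 1)).
    have n1 : 0 < 2 * (`|G j k1| + 1) by have := normr_ge0 (G j k1); lra.
    have e0 : 0 < e by rewrite divr_gt0//; lra.
    exists (1 *: k + e *: k1); first by apply: CC => //; exact: ltW.
    move=> i iA; rewrite scalar_comb// mul1r.
    have [->|ij] := eqVneq i j.
      have eE : e * (2 * (`|G j k1| + 1)) = - G j k by rewrite divfK// gt_eqF.
      by have := ler_norm (G j k1); nra.
    by have := Gk i (inD i iA ij); have := Gk1 i (inD i iA ij); nra.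
  exists (fun i => if i == j then 1 else p i); split.
  - by move=> i; case: ifP.
  - by exists j => //; rewrite eqxx.
  - by move=> k Ck; rewrite sum_updated//; have := Hp k Ck; lra.
move=> [p [p0 [i0 i0A pi0] Hp]]; right.
exists (fun i => if i == j then 0 else p i); split.
- by move=> i; case: ifP.
- move: i0A; rewrite !inE => /andP[ij iA].
  by exists i0 => //; rewrite (negbTE ij).
- by move=> k Ck; rewrite sum_updated// mul0r add0r; exact: Hp.
Qed.

Lemma farkas_dominated G A C F :
  convex_cone C -> (forall i, scalar (G i)) -> scalar F ->
  (forall k, C k -> exists k', [/\ C k',
     forall i, i \in A -> G i k' <= 0 & C (k' - k)]) ->
  (forall k, C k -> (forall i, i \in A -> G i k <= 0) -> F k <= 0) ->
  exists2 p : I -> R, forall i, 0 <= p i &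
    forall k, C k -> F k <= \sum_(i in A) p i * G i k.
Proof.
move=> + Gl; move: {2}#|A|.+1 (ltnSn #|A|) => n.
elim: n A C F => [//|n IH] A C F cA CC Fl dom imp.
have [[k0 Ck0]|C0] := pselect (exists k, C k); last first.
  by exists (fun=> 0) => // k Ck; case: C0; exists k.
have [[k1 Ck1 Gk1]|[q [q0 [j jA qj] Hq]]] := gordan_alternative A CC Gl Ck0.
  exact: (slater_multipliers CC Gl Fl Ck1 Gk1).
pose h k := \sum_(i in A) q i * G i k.
have hl : scalar h by exact: scalar_sum.
have h_le0 k : (forall i, i \in A -> G i k <= 0) -> h k <= 0.
  by move=> Gk; apply: sumr_le0 => i iA; rewrite mulr_ge0_le0// Gk.
(* Since [k' - k] is in [C], [h k <= h k']; since [k'] satisfies the constraints, [h k' <= 0]. *)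
have h0 k : C k -> h k = 0.
  move=> Ck; have [k' [Ck' Gk' Ckk']] := dom k Ck.
  have := Hq _ Ckk'; rewrite -/(h _) scalarB//.
  by have := Hq _ Ck; have := h_le0 _ Gk'; rewrite -/(h k); lra.
(* The terms of [h k] are all at most 0 and add up to 0, so the one with the positive coefficient
   [q j] vanishes. *)
have Gj0 k : C k -> (forall i, i \in A -> G i k <= 0) -> G j k = 0.
  move=> Ck Gk; have := h0 _ Ck; rewrite /h (big_setD1 _ jA) /=.
  have : \sum_(i in A :\ j) q i * G i k <= 0.
    apply: sumr_le0 => i; rewrite !inE => /andP[_ iA].
    by rewrite mulr_ge0_le0// Gk.
  by have := Gk j jA; nra.
have inD i : i \in A -> i != j -> i \in A :\ j by move=> iA ij; rewrite !inE ij.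
pose C' := C `&` [set k | G j k = 0].
have [|||||p p0 Hp] := IH (A :\ j) C' F.
- by move: cA; rewrite (cardsD1 j) jA.
- move=> a b u v a0 b0 [Cu Gu] [Cv Gv]; split; first exact: CC.
  by rewrite /= scalar_comb// Gu Gv; ring.
- exact: Fl.
(* The dominating point found in [C] already lies on the hyperplane [G j = 0], and so does its
   difference with [k]. *)
- move=> k [Ck Gk]; have [k' [Ck' Gk' Ckk']] := dom k Ck; exists k'.
  have Gjk' := Gj0 _ Ck' Gk'; split => //.
    by move=> i; rewrite !inE => /andP[_]; exact: Gk'.
  by split => //=; rewrite scalarB// Gjk' Gk subrr.
- move=> k [Ck Gk] H; apply: imp => // i iA.
  by have [->|ij] := eqVneq i j; [rewrite Gk|apply: H; exact: inD].
pose F' k := F k - \sum_(i in A :\ j) p i * G i k.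
have Fl' : scalar F'.
  by move=> a u v; rewrite /F' Fl (scalar_sum _ _ Gl) /=; ring.
have F'le k : C k -> G j k = 0 -> F' k <= 0.
  by move=> Ck Gk; rewrite subr_le0; exact: Hp.
(* If [G j] is nonzero at some [k] of [C], then it takes the opposite value at [k' - k], so both
   signs occur on [C] and the equality multiplier is available. *)
have [c Hc] : exists c, forall k, C k -> F' k <= c * G j k.
  have [[k [Ck Gk]]|all0] := pselect (exists k, C k /\ G j k != 0); last first.
    exists 0 => k Ck; rewrite mul0r; apply: F'le => //; apply/eqP/negPn/negP => Gk.
    by apply: all0; exists k.
  have [k' [Ck' Gk' Ckk']] := dom k Ck.
  have GN : G j (k' - k) = - G j k by rewrite scalarB// (Gj0 _ Ck' Gk') sub0r.
  move: Gk; rewrite neq_lt => /orP[Gk|Gk].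
    by apply: (equality_multiplier CC (Gl j) Fl' Ck Gk Ckk' _ F'le); lra.
  by apply: (equality_multiplier CC (Gl j) Fl' Ckk' _ Ck Gk F'le); lra.
(* Since h vanishes on C, adding a large multiple of it makes the coefficient
   c of G j, whose sign is arbitrary, nonnegative. *)
exists (fun i => (if i == j then c else p i) + `|c| / q j * q i).
  move=> i; have [->|_] := eqVneq i j.
    by rewrite divfK ?gt_eqF//; have := ler_norm (- c); rewrite normrN; lra.
  by rewrite addr_ge0// mulr_ge0// divr_ge0// ltW.
move=> k Ck; rewrite (eq_bigr (fun i =>
  (if i == j then c else p i) * G i k + `|c| / q j * (q i * G i k))).
  rewrite big_split /= -mulr_sumr sum_updated// -/(h k) h0// mulr0 addr0.
  by rewrite -lerBlDr; exact: Hc.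
by move=> i _; rewrite mulrDl mulrA.
Qed.

End farkas.

(** * Integrals against sums, multiples and restrictions of measures *)

Section measure_combinations.
Context {R : realType} {disp : measure_display} {T : measurableType disp}.
Implicit Types (m : {measure set T -> \bar R}) (f : T -> R).

Local Notation integrable m f := (m.-integrable [set: T] (EFin \o f)).

Lemma integrable_measure_add m1 m2 f : integrable m1 f -> integrable m2 f ->
  integrable (measure_add m1 m2) f.
Proof.
move=> /integrableP[mf i1] /integrableP[_ i2]; apply/integrableP; split => //.
rewrite ge0_integral_measure_add//; first exact: lte_add_pinfty.
exact: measurableT_comp.
Qed.

Lemma Rintegral_measure_add m1 m2 f : integrable m1 f -> integrable m2 f ->
  \int[measure_add m1 m2]_x f x = \int[m1]_x f x + \int[m2]_x f x.
Proof.
move=> i1 i2; rewrite /Rintegral integral_measure_add// fineD//.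
  exact: integrable_fin_num.
exact: integrable_fin_num.
Qed.

Lemma integrable_mscale (a : {nonneg R}) m f : integrable m f ->
  integrable (mscale a m) f.
Proof.
move=> /integrableP[mf i1]; apply/integrableP; split => //.
rewrite ge0_integral_mscale//; last exact: measurableT_comp.
by rewrite lte_mul_pinfty.
Qed.

Lemma Rintegral_mscale (a : {nonneg R}) m f : integrable m f ->
  \int[mscale a m]_x f x = a%:num * \int[m]_x f x.
Proof.
move=> i1; have /integrableP[mf _] := i1.
rewrite /Rintegral integralE [in RHS]integralE.
have fp : (\int[m]_x (EFin \o f)^\+ x)%E \is a fin_num.
  exact/integrable_fin_num/integrable_funepos.
have fn : (\int[m]_x (EFin \o f)^\- x)%E \is a fin_num.
  exact/integrable_fin_num/integrable_funeneg.
rewrite !ge0_integral_mscale//; last 2 first.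
  exact: measurable_funeneg.
  exact: measurable_funepos.
rewrite fineB ?fin_numM//.
by rewrite fineB ?fin_numM// !fineM// mulrBr.
Qed.

Lemma integral_mrestr m (A : set T) (mA : measurable A) (h : T -> \bar R) :
  measurable_fun [set: T] h ->
  (\int[mrestr m mA]_x h x = \int[m]_(x in A) h x)%E.
Proof.
move=> mh; rewrite -(setUv A) integral_setU//; last 3 first.
- exact: measurableC.
- by rewrite setUv.
- exact/disj_setPCl.
rewrite [X in (_ + X)%E]null_set_integral ?adde0//; last 3 first.
- exact: measurableC.
- exact: measurable_funTS.
- by rewrite /= /mrestr setICl measure0.
apply: eq_measure_integral => B mB BA.
by rewrite /= /mrestr (setIidl BA).
Qed.

Lemma integrable_mrestr m (A : set T) (mA : measurable A) f :
  integrable m f -> integrable (mrestr m mA) f.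
Proof.
move=> /integrableP[mf i1]; apply/integrableP; split => //.
rewrite integral_mrestr; last exact: measurableT_comp.
apply: le_lt_trans i1; apply: ge0_subset_integral => //.
exact: measurableT_comp.
Qed.

End measure_combinations.

(** * The moment cone and a multiplier common to the whole hypothesis *)

Section multiplier.
Context {R : realType} {disp : measure_display} {T : measurableType disp}.
Context (d : nat) (g : 'I_d -> T -> R) (nu : {measure set T -> \bar R}).
Implicit Types (m : {measure set T -> \bar R}) (f : T -> R).

Local Notation integrable m f := (m.-integrable [set: T] (EFin \o f)).
Local Notation P := (dominated_part (hypothesis (range g)) nu).

(** Integrability makes the integrals finite, so the constraints can be read in the reals, where the
    moments live. *)
Lemma dominated_hypothesisP (mu : probability T R) :
  P mu <-> (forall i, integrable mu (g i) /\ \int[mu]_x g i x <= 0) /\ mu `<< nu.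
Proof.
have E i : integrable mu (g i) ->
    (\int[mu]_x (g i x)%:E <= 0)%E = (\int[mu]_x g i x <= 0).
  by move=> ig; rewrite -lee_fin fineK//; exact: integrable_fin_num.
split=> [[H dom]|[H dom]]; split => //.
  move=> i; have [|ig le0] := H (g i); first by exists i.
  by rewrite -E.
by move=> _ [i _ <-]; have [ig le0] := H i; rewrite E.
Qed.

(** Measures with real moments, whose finite mass allows them to be normalized when nonzero. *)
Let regular f m : Prop := [/\ (m [set: T] < +oo)%E, m `<< nu,
  forall i, integrable m (g i) & integrable m f].

(** [R^o] is the real line as a module over itself, which makes the pairs vectors of a module over
    [R]. *)
Let moments f m : 'rV[R]_d * R^o :=
  (\row_i \int[m]_x g i x, \int[m]_x f x).

(* Multiples of the dominated probability measures in the hypothesis, and the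
   measures below them. *)
Let moment_cone f : set ('rV[R]_d * R^o) :=
  [set v | exists m m', [/\ regular f m, regular f m',
     forall i, \int[m]_x g i x + \int[m']_x g i x <= 0 & v = moments f m]].

Let mcomb (a b : {nonneg R}) m1 m2 : {measure set T -> \bar R} :=
  measure_add (mscale a m1) (mscale b m2).

Let mcombE a b m1 m2 A :
  mcomb a b m1 m2 A = (a%:num%:E * m1 A + b%:num%:E * m2 A)%E.
Proof. exact: measure_addE. Qed.

Let regular_mcomb f a b m1 m2 : regular f m1 -> regular f m2 ->
  regular f (mcomb a b m1 m2).
Proof.
move=> [fin1 dom1 ig1 if1] [fin2 dom2 ig2 if2]; split.
- by rewrite mcombE; apply: lte_add_pinfty; rewrite lte_mul_pinfty.
- apply/null_content_dominatesP => A mA nuA.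
  rewrite mcombE; move/null_content_dominatesP : dom1 => ->//.
  by move/null_content_dominatesP : dom2 => ->//; rewrite !mule0 adde0.
- by move=> i; apply: integrable_measure_add; exact: integrable_mscale.
- by apply: integrable_measure_add; exact: integrable_mscale.
Qed.

Let Rintegral_mcomb (a b : {nonneg R}) m1 m2 f :
  integrable m1 f -> integrable m2 f ->
  \int[mcomb a b m1 m2]_x f x =
  a%:num * \int[m1]_x f x + b%:num * \int[m2]_x f x.
Proof.
move=> i1 i2.
by rewrite Rintegral_measure_add ?Rintegral_mscale//; exact: integrable_mscale.
Qed.

Let convex_moment_cone f : convex_cone (moment_cone f).
Proof.
move=> a b _ _ a0 b0 [m1 [m1' [r1 r1' le1 ->]]] [m2 [m2' [r2 r2' le2 ->]]].
exists (mcomb (NngNum a0) (NngNum b0) m1 m2).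
exists (mcomb (NngNum a0) (NngNum b0) m1' m2').
have [_ _ g1 f1] := r1; have [_ _ g1' f1'] := r1'.
have [_ _ g2 f2] := r2; have [_ _ g2' f2'] := r2'.
split; [exact: regular_mcomb|exact: regular_mcomb| |].
- by move=> i; rewrite !Rintegral_mcomb//=; have := le1 i; have := le2 i; nra.
- congr pair; last by rewrite /= Rintegral_mcomb.
  by apply/rowP => i; rewrite !mxE Rintegral_mcomb.
Qed.

(** The witness [m'] completes [m] to a measure satisfying all constraints. The dominating point is
    the moment vector of [m + m']; the difference is that of [m'], which in turn is completed by
    [m]. *)
Let moment_cone_dominated f v : moment_cone f v ->
  exists v', [/\ moment_cone f v', forall i, v'.1 0 i <= 0 &
    moment_cone f (v' - v)].
Proof.
move=> [m [m' [r r' le0 ->]]]; have [_ _ ig if_] := r.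
have [_ _ ig' if'] := r'.
pose one : {nonneg R} := NngNum ler01; pose s := mcomb one one m m'.
have rs : regular f s by exact: regular_mcomb.
have [_ _ igs ifs] := rs.
have gs i : \int[s]_x g i x = \int[m]_x g i x + \int[m']_x g i x.
  by rewrite Rintegral_mcomb// !mul1r.
have fs : \int[s]_x f x = \int[m]_x f x + \int[m']_x f x.
  by rewrite Rintegral_mcomb// !mul1r.
exists (moments f s); split.
- exists s, s; split => // i; rewrite gs; have := le0 i; lra.
- by move=> i; rewrite mxE gs.
- exists m', m; split => //.
    by move=> i; rewrite addrC.
  congr pair; last by rewrite /= fs addrC addKr.
  by apply/rowP => i; rewrite !mxE gs addrC addKr.
Qed.

(** A nonzero [m] whose own moments satisfy the constraints is a positive multiple of an element of
    [P]; the integrals against the zero measure vanish. *)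
Let moment_cone_le0 f v :
  (forall mu, P mu -> (\int[mu]_x (f x)%:E <= 0)%E) ->
  moment_cone f v -> (forall i, v.1 0 i <= 0) -> v.2 <= 0.
Proof.
move=> Pf [m [m' [[fin dom ig if_] _ _ ->]]] le0 /=.
have [m0|m0] := eqVneq (m [set: T]) 0%E.
  rewrite /Rintegral null_set_integral//.
  by have /integrableP[] := if_.
have finm : m [set: T] \is a fin_num by rewrite ge0_fin_numE.
have c0 : 0 < fine (m [set: T]) by rewrite fine_gt0// fin lt0e m0 measure_ge0.
have cV0 : 0 <= (fine (m [set: T]))^-1 by rewrite invr_ge0 ltW.
(* The Dirac measure is the default value of [mnormalize] for mass zero or infinite, both excluded
   here. *)
pose mu : probability T R := mnormalize m (dirac (point : T)).
have muE A : mu A = mscale (NngNum cV0) m A.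
  rewrite /mu /= /mnormalize (negbTE m0) /=.
  case: eqP => [moo|_]; first by rewrite moo in fin.
  by rewrite /mscale muleC.
have intE (h : T -> R) : (\int[mu]_x (h x)%:E = \int[mscale (NngNum cV0) m]_x (h x)%:E)%E.
  by apply: eq_measure_integral => A _ _; exact: muE.
have intgE (h : T -> R) : integrable m h -> integrable mu h.
  move=> /(integrable_mscale (NngNum cV0)) /integrableP[mh ih].
  apply/integrableP; split => //.
  rewrite (eq_measure_integral (mscale (NngNum cV0) m))// => A _ _.
  exact: muE.
have RintE (h : T -> R) : integrable m h ->
    \int[mu]_x h x = (fine (m [set: T]))^-1 * \int[m]_x h x.
  by move=> /(Rintegral_mscale (NngNum cV0)) /= <-; rewrite /Rintegral intE.
have Pmu : P mu.
  apply/dominated_hypothesisP; split.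
    move=> i; split; first exact: intgE.
    by rewrite RintE// mulr_ge0_le0//; have := le0 i; rewrite mxE.
  apply/null_content_dominatesP => A mA nuA; rewrite muE /mscale.
  by move/null_content_dominatesP : dom => /(_ A mA nuA) ->; rewrite mule0.
have : \int[mu]_x f x <= 0.
  by rewrite -lee_fin fineK ?Pf//; exact/integrable_fin_num/intgE.
by rewrite RintE// pmulr_rle0// invr_gt0.
Qed.

Lemma measurable_lincomb (w : 'rV[R]_d) :
  (forall i, measurable_fun [set: T] (g i)) ->
  measurable_fun [set: T] (lincomb g w).
Proof.
move=> mg; apply: (measurable_sum _ (h := fun i x => w 0 i * g i x)) => i.
exact: measurable_funM.
Qed.

Lemma integrable_lincomb m (w : 'rV[R]_d) :
  (forall i, integrable m (g i)) -> integrable m (lincomb g w).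
Proof.
move=> ig.
rewrite (_ : _ \o _ = fun x => (\sum_(i < d) ((w 0 i)%:E * (g i x)%:E)%E)%R).
  apply: integrable_sum => // i _.
  exact: (integrableZl measurableT (w 0 i) (ig i)).
by apply/funext => x; rewrite /= /lincomb -sumEFin.
Qed.

Lemma Rintegral_lincomb m (w : 'rV[R]_d) :
  (forall i, integrable m (g i)) ->
  \int[m]_x lincomb g w x = \sum_(i < d) w 0 i * \int[m]_x g i x.
Proof.
move=> ig; have iZ i := integrableZl measurableT (w 0 i) (ig i).
rewrite /Rintegral; under eq_integral do rewrite /lincomb -sumEFin.
rewrite integral_sum// -sum_fine.
  apply: eq_bigr => i _; exact: (RintegralZl _ measurableT (ig i)).
by move=> i _; apply: integrable_fin_num => //; exact: iZ.
Qed.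

(** On the set where [0 < h] the integral of [h] is both at most 0 and at least 0, so [h] vanishes
    almost everywhere there. *)
Lemma le0_restrictions_ae (mu : probability T R) (h : T -> R) :
  integrable mu h -> (forall A, measurable A -> \int[mu]_(x in A) h x <= 0) ->
  mu [set x | 0 < h x] = 0%E.
Proof.
move=> ih H; have /integrableP[mh _] := ih.
pose A := [set x | 0 < h x].
have mA : measurable A.
  have := measurable_lte measurableT (measurable_cst 0%E) mh.
  by rewrite setTI.
have mhA : measurable_fun A (EFin \o h) by exact: measurable_funTS.
have ihA : mu.-integrable A (EFin \o h) by exact: integrableS ih.
have hA0 : (\int[mu]_(x in A) (h x)%:E = 0)%E.
  apply/eqP; rewrite eq_le; apply/andP; split.
    by rewrite -[X in (X <= _)%E]fineK ?lee_fin ?H//; exact: integrable_fin_num.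
  by apply: integral_ge0 => x /ltW; rewrite lee_fin.
have : (\int[mu]_(x in A) `|(EFin \o h) x| = 0)%E.
  rewrite -hA0; apply: eq_integral => x; rewrite inE => /ltW h0.
  by rewrite /= ger0_norm.
move=> /(ae_eq_integral_abs mu mA mhA) [N [mN N0 sub]].
apply/eqP; rewrite -measure_le0 -N0 le_measure ?inE//.
move=> x Ax; apply: sub => /= /(_ Ax) [h0].
by move: Ax; rewrite /A /= h0 ltxx.
Qed.

Lemma exists_multiplier f : Q_integrable P f ->
  (forall mu, P mu -> (\int[mu]_x (f x)%:E <= 0)%E) ->
  exists2 w : 'rV[R]_d, nonneg_orthant w &
    forall mu, P mu -> mu [set x | 0 < f x - lincomb g w x] = 0%E.
Proof.
move=> [mf Pintf] Pf.
have Gl (i : 'I_d) : scalar (fun v : 'rV[R]_d * R^o => v.1 0 i).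
  by move=> a u v /=; rewrite !mxE.
have Fl : scalar (fun v : 'rV[R]_d * R^o => v.2) by [].
have [||p p0 Hp] := farkas_dominated (A := [set: 'I_d]%SET)
  (@convex_moment_cone f) Gl Fl.
- move=> v /moment_cone_dominated[v' [? le0 ?]]; exists v'.
  by split => // i _; exact: le0.
- move=> v Cv le0; apply: (moment_cone_le0 Pf Cv) => i.
  by apply: le0; rewrite inE.
pose w : 'rV[R]_d := \row_i p i.
(* The multiplier is fixed before any [mu] is chosen. *)
exists w; first by move=> i; rewrite mxE.
move=> mu Pmu; have intf := Pintf _ Pmu.
have /dominated_hypothesisP[Pg dom] := Pmu.
have ig i : integrable mu (g i) by case: (Pg i).
apply: le0_restrictions_ae.
  rewrite (_ : EFin \o _ = (EFin \o f) \- (EFin \o lincomb g w))%E//.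
  by apply: integrableB => //; exact: integrable_lincomb.
have reg A (mA : measurable A) : regular f (mrestr mu mA).
  split.
  - by rewrite /= /mrestr setTI (le_lt_trans (probability_le1 _ _))// ltry.
  - apply/null_content_dominatesP => B mB nuB /=; rewrite /mrestr.
    apply/eqP; rewrite -measure_le0.
    move/null_content_dominatesP : dom => /(_ B mB nuB) <-.
    by rewrite le_measure ?inE//; exact: measurableI.
  - by move=> i; exact: integrable_mrestr.
  - exact: integrable_mrestr.
have RE A (mA : measurable A) (h : T -> R) : integrable mu h ->
    \int[mrestr mu mA]_x h x = \int[mu]_(x in A) h x.
  move=> /integrableP[mh _]; by rewrite /Rintegral integral_mrestr.
move=> A mA; rewrite RintegralB//; last 2 first.
- exact: integrableS intf.
- by apply: integrableS (integrable_lincomb _ ig).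
rewrite subr_le0 -!(RE _ mA)//; last exact: integrable_lincomb.
rewrite Rintegral_lincomb; last by move=> i; exact: integrable_mrestr.
have := Hp (moments f (mrestr mu mA)) _.
rewrite /= => /(_ _)/le_trans; apply.
  (* The restrictions of [mu] to [A] and to its complement add up to [mu], which satisfies the
     constraints. *)
  exists (mrestr mu mA), (mrestr mu (measurableC mA)); split => //.
  - move=> i; rewrite !RE// -Rintegral_setU//.
    + by rewrite setUv; have [] := Pg i.
    + exact: measurableC.
    + by rewrite setUv.
    + exact/disj_setPCl.
rewrite le_eqVlt; apply/orP; left; apply/eqP.
by apply: eq_big => [i|i _]; rewrite ?inE// !mxE.
Qed.

End multiplier.

(** * Calculus of quasi-sure properties *)

Section quasi_sure.
Context {R : realType} {disp : measure_display} {T : measurableType disp}.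
Implicit Types (Q : set (probability T R)) (p q r : T -> Prop).

(** The failure set of [r] lies in the union of those of [p] and [q]; its measurability does not
    follow from this inclusion. *)
Lemma quasi_surely_impl2 Q p q r : quasi_surely Q p -> quasi_surely Q q ->
  measurable [set x | ~ r x] -> (forall x, p x -> q x -> r x) ->
  quasi_surely Q r.
Proof.
move=> [mp p0] [mq q0] mr imp; split => // mu Qmu; apply/eqP.
rewrite -measure_le0 -(p0 _ Qmu) -[leRHS]adde0 -[X in (_ + X)%E](q0 _ Qmu).
apply: le_trans (measureU2 _ mp mq).
rewrite le_measure ?inE//; first exact: measurableU.
move=> x /= nr; apply: contrapT => /not_orP[/contrapT px /contrapT qx].
exact/nr/imp.
Qed.

Lemma quasi_surely_impl Q p r : quasi_surely Q p ->
  measurable [set x | ~ r x] -> (forall x, p x -> r x) -> quasi_surely Q r.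
Proof.
by move=> Qp mr imp; apply: (quasi_surely_impl2 Qp Qp) => // x /imp.
Qed.

Lemma quasi_surely_ae Q p (mu : probability T R) :
  quasi_surely Q p -> Q mu -> \forall x \ae mu, p x.
Proof. by move=> [mp p0] Qmu; exists [set x | ~ p x]; split => //; exact: p0. Qed.

Lemma measurable_not_lee (h k : T -> \bar R) : measurable_fun [set: T] h ->
  measurable_fun [set: T] k -> measurable [set x | ~ (h x <= k x)%E].
Proof.
move=> mh mk; have := measurable_lee measurableT mh mk.
by rewrite setTI => /measurableC.
Qed.

Lemma measurable_not_eqe (h k : T -> \bar R) : measurable_fun [set: T] h ->
  measurable_fun [set: T] k -> measurable [set x | ~ (h x = k x)].
Proof.
move=> mh mk; have := measurable_eqe measurableT mh mk.
by rewrite setTI => /measurableC.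
Qed.

Lemma measurable_not_le (f f' : T -> R) : measurable_fun [set: T] f ->
  measurable_fun [set: T] f' -> measurable [set x | ~ (f x <= f' x)].
Proof.
move=> mf mf'; have := @measurable_not_lee (EFin \o f) (EFin \o f').
rewrite (_ : [set x | _] = [set x | ~ (f x <= f' x)]).
  by apply; exact/measurable_EFinP.
by apply/seteqP; split => x /=; rewrite lee_fin.
Qed.

Lemma quasi_surely_le_integral Q (mu : probability T R) (f f' : T -> \bar R) :
  quasi_surely Q (fun x => (f x <= f' x)%E) -> Q mu ->
  mu.-integrable [set: T] f -> mu.-integrable [set: T] f' ->
  (\int[mu]_x f x <= \int[mu]_x f' x)%E.
Proof.
move=> [mN N0] Qmu intf intf'; pose N := [set x | ~ (f x <= f' x)%E].
have muN : mu N = 0%E by exact: N0.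
rewrite (negligible_integral mN measurableT intf muN).
rewrite (negligible_integral mN measurableT intf' muN).
have mTN : measurable ([set: T] `\` N) by exact: measurableD.
apply: le_integral => //.
- exact: integrableS intf.
- exact: integrableS intf'.
by move=> x; rewrite inE => -[_ /contrapT].
Qed.

End quasi_sure.

(** * E-variables and admissibility *)

Section evariables.
Context {R : realType} {disp : measure_display} {T : measurableType disp}.
Context (d : nat) (g : 'I_d -> T -> R).
Context (g_meas : forall i, measurable_fun [set: T] (g i)).
Context (nu : {measure set T -> \bar R}).

Local Notation P := (dominated_part (hypothesis (range g)) nu).
Local Notation W := [set w : 'rV[R]_d | nonneg_orthant w /\
  quasi_surely P (fun x => 0 <= 1 + lincomb g w x)].

Let mlin (w : 'rV[R]_d) : measurable_fun [set: T] (lincomb g w).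
Proof. exact: measurable_lincomb. Qed.

Let mlin1 (w : 'rV[R]_d) :
  measurable_fun [set: T] (fun x => (1 + lincomb g w x)%:E).
Proof. by apply/measurable_EFinP; apply: measurable_funD. Qed.

Let intlin (mu : probability T R) w :
  P mu -> mu.-integrable [set: T] (EFin \o lincomb g w).
Proof.
move=> /dominated_hypothesisP[H _].
by apply: integrable_lincomb => i; case: (H i).
Qed.

Let integral_one (mu : probability T R) :
  (\int[mu]_x (EFin \o cst 1%R) x = 1)%E.
Proof.
by rewrite -[RHS](probability_setT mu) -[RHS]mul1e -integral_cst.
Qed.

Lemma integral_lincomb_le0 (mu : probability T R) (w : 'rV[R]_d) :
  nonneg_orthant w -> P mu -> (\int[mu]_x (lincomb g w x)%:E <= 0)%E.
Proof.
move=> w0 Pmu; have /dominated_hypothesisP[H _] := Pmu.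
rewrite -[X in (X <= _)%E]fineK ?lee_fin; last first.
  exact/integrable_fin_num/intlin.
rewrite -/(Rintegral _ _ _) [X in X <= _]Rintegral_lincomb.
  by apply: sumr_le0 => i _; rewrite mulr_ge0_le0//; case: (H i).
by move=> i; case: (H i).
Qed.

(** The constraint given by the indicator of [A] reads [mu A <= 0], that is [mu A = 0]. *)
Lemma hypothesis_null_indicators :
  P = hypothesis (with_null_indicators (range g) nu).
Proof.
apply/seteqP; split => mu.
  move=> [H /null_content_dominatesP dom] f [/H//|[A [mA nuA ->]]].
  split; first exact: integrable_indic.
  have le0 : (mu A <= 0)%E by rewrite dom.
  by rewrite integral_indic// setIT.
move=> H; split; first by move=> f gf; apply: H; left.
apply/null_content_dominatesP => A mA nuA.
have [|_] := H \1_A; first by right; exists A.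
by rewrite integral_indic// setIT measure_le0 => /eqP.
Qed.

Lemma integral_le0P (f : T -> R) : Q_integrable P f ->
  ((forall mu, P mu -> (\int[mu]_x (f x)%:E <= 0)%E) <->
   exists2 w, nonneg_orthant w &
     quasi_surely P (fun x => f x <= lincomb g w x)).
Proof.
move=> Qf; have [mf Pf] := Qf; split.
  move=> /(exists_multiplier Qf)[w w0 Pw]; exists w => //; split.
    exact: measurable_not_le.
  move=> mu /Pw; rewrite (_ : [set x | _] = [set x | ~ (f x <= lincomb g w x)])//.
  by apply/seteqP; split => x /=; rewrite subr_gt0 ltNge => /negP.
move=> [w w0 Pw] mu Pmu; apply: le_trans (integral_lincomb_le0 w0 Pmu).
exact: (@quasi_surely_le_integral _ _ _ P mu (EFin \o f) (EFin \o lincomb g w)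
  Pw Pmu (Pf _ Pmu) (intlin w Pmu)).
Qed.

(** The criterion for real functions is applied to [fine (h x) - 1]; since [h] has integral at most
    1, it is quasi-surely finite and agrees with its real part. *)
Lemma evariable_dominated (h : T -> \bar R) : is_evariable P h ->
  exists2 w, nonneg_orthant w &
    quasi_surely P (fun x => (h x <= (1 + lincomb g w x)%:E)%E).
Proof.
move=> [mh h0 Ph].
have inth mu : P mu -> mu.-integrable [set: T] h.
  move=> Pmu; apply/integrableP; split => //.
  under eq_integral do rewrite gee0_abs//.
  by rewrite (le_lt_trans (Ph _ Pmu))// ltry.
have mfh : measurable_fun [set: T] (fun x => fine (h x)).
  exact: (measurableT_comp (fine_measurable measurableT)).
have Pfin : quasi_surely P (fun x => h x = (fine (h x))%:E).
  have mNfin : measurable [set x | ~ h x = (fine (h x))%:E].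
    by apply: measurable_not_eqe => //; exact/measurable_EFinP.
  split => // mu Pmu; have := integrable_ae measurableT (inth _ Pmu).
  move=> [N [mN N0 sub]]; apply/eqP.
  rewrite -measure_le0 -N0 le_measure ?inE//.
  move=> x /= hx; apply: sub => /= /(_ I) hfin; apply: hx.
  by rewrite fineK.
pose f x := fine (h x) - 1.
have mf : measurable_fun [set: T] f by exact: measurable_funB.
(* [fine] sends [+oo] to 0, so the inequality also holds where [h] is infinite. *)
have lef x : ((fine (h x))%:E <= h x)%E.
  by have := h0 x; case: (h x) => //= _; rewrite leey.
have intf mu : P mu -> mu.-integrable [set: T] (EFin \o (fun x => fine (h x))).
  move=> Pmu; apply: le_integrable (inth _ Pmu) => //.
    exact/measurable_EFinP.
  move=> x _; rewrite gee0_abs ?gee0_abs//=.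
  by rewrite lee_fin fine_ge0.
have int1 (mu : probability T R) : mu.-integrable [set: T] (EFin \o cst 1).
  exact: finite_measure_integrable_cst.
have [||w w0 Pw] := (integral_le0P (f := f) _).1.
- split => // mu Pmu; rewrite (_ : _ \o _ =
    (EFin \o (fun x => fine (h x))) \- (EFin \o cst 1%R))%E//.
  exact: integrableB (intf _ Pmu) (int1 mu).
- move=> mu Pmu; rewrite (integralB_EFin measurableT (intf _ Pmu) (int1 mu)).
  rewrite integral_one sube_le0; apply: le_trans (Ph _ Pmu).
  by apply: le_integral => //; [exact: intf|exact: inth].
exists w => //; apply: (quasi_surely_impl2 Pfin Pw).
  exact: measurable_not_lee.
by move=> x -> /=; rewrite lee_fin /f lerBlDl.
Qed.

Lemma dominated_evariable (h : T -> \bar R) w :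
  measurable_fun [set: T] h -> (forall x, (0 <= h x)%E) -> nonneg_orthant w ->
  quasi_surely P (fun x => (h x <= (1 + lincomb g w x)%:E)%E) ->
  is_evariable P h.
Proof.
move=> mh h0 w0 Pw; split => // mu Pmu.
have int1 : mu.-integrable [set: T] (EFin \o cst 1).
  exact: finite_measure_integrable_cst.
have intL : mu.-integrable [set: T] (fun x => (1 + lincomb g w x)%:E).
  rewrite (_ : (fun _ => _) = (EFin \o cst 1%R) \+ (EFin \o lincomb g w))%E//.
  by apply: integrableD => //; exact: intlin.
have inth : mu.-integrable [set: T] h.
  apply/integrableP; split => //.
  have /integrableP[_] := intL; apply: le_lt_trans.
  apply: ae_ge0_le_integral => //.
  - exact: measurableT_comp.
  - exact: measurableT_comp.
  have := quasi_surely_ae Pw Pmu; apply: filterS => x le1 _.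
  by rewrite gee0_abs// (le_trans le1)// lee_abs.
apply: le_trans (quasi_surely_le_integral Pw Pmu inth intL) _.
rewrite integralD_EFin//; last exact: intlin.
by rewrite integral_one -[leRHS]adde0 leeD2l// integral_lincomb_le0.
Qed.

Lemma evariableP (h : T -> \bar R) : is_evariable P h <->
  [/\ measurable_fun [set: T] h, (forall x, (0 <= h x)%E) &
      exists2 w, nonneg_orthant w &
        quasi_surely P (fun x => (h x <= (1 + lincomb g w x)%:E)%E)].
Proof.
split=> [Eh|[mh h0 [w w0 Pw]]]; last exact: dominated_evariable Pw.
by have [mh h0 _] := Eh; split => //; exact: evariable_dominated.
Qed.

Lemma admissible_affine (h : T -> \bar R) : admissible P h ->
  exists2 w, W w & quasi_surely P (fun x => h x = (1 + lincomb g w x)%:E).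
Proof.
move=> [Eh adm]; have [mh h0 _] := Eh.
have [w w0 Pw] := evariable_dominated Eh.
have Pw0 : quasi_surely P (fun x => 0 <= 1 + lincomb g w x).
  apply: quasi_surely_impl Pw _ _.
    by apply: (@measurable_not_le _ _ _ (cst 0)) => //; exact: measurable_funD.
  by move=> x; rewrite -lee_fin; exact: le_trans.
(* An e-variable is nonnegative everywhere, but the affine bound only quasi-surely, hence the
   truncation at 0. The result is an e-variable above [h], and admissibility makes them equal. *)
exists w => //; pose h' x := maxe 0%E (1 + lincomb g w x)%:E.
have mh' : measurable_fun [set: T] h' by exact: measurable_maxe.
have h'0 x : (0 <= h' x)%E by rewrite le_max lexx.
have Eh' : is_evariable P h'.
  apply: (dominated_evariable mh' h'0 w0).
  apply: quasi_surely_impl Pw0 _ _; first exact: measurable_not_lee.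
  by move=> x ge0; rewrite ge_max lee_fin ge0 lexx.
have Phh' : quasi_surely P (fun x => h' x = h x).
  apply: adm => //; apply: quasi_surely_impl Pw _ _.
    exact: measurable_not_lee.
  by move=> x le1; rewrite le_max le1 orbT.
apply: quasi_surely_impl2 Phh' Pw0 _ _; first exact: measurable_not_eqe.
by move=> x <- ge0; apply/max_idPr; rewrite lee_fin.
Qed.

Lemma cone_lincomb w : nonneg_orthant w ->
  cone (with_null_indicators (range g) nu) (lincomb g w).
Proof.
by move=> w0; exists d, (fun i => w 0 i), g; split => // i; left; exists i.
Qed.

(** An e-variable [h'] above [h] lies below some [1 + lincomb g w']. Then
    [lincomb g w <= lincomb g w'] quasi-surely, maximality in the cone gives equality, and [h'] is
    squeezed back onto [h]. *)
Lemma affine_admissible (h : T -> \bar R) w :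
  (forall f f' : T -> R, cone (with_null_indicators (range g) nu) f ->
    cone (with_null_indicators (range g) nu) f' ->
    quasi_surely P (fun x => f x <= f' x) ->
    quasi_surely P (fun x => f x = f' x)) ->
  measurable_fun [set: T] h -> (forall x, (0 <= h x)%E) -> nonneg_orthant w ->
  quasi_surely P (fun x => h x = (1 + lincomb g w x)%:E) ->
  admissible P h.
Proof.
move=> maxcone mh h0 w0 Pw; split.
  apply: (dominated_evariable mh h0 w0).
  apply: quasi_surely_impl Pw _ _; first exact: measurable_not_lee.
  by move=> x ->.
move=> h' Eh' Phh'; have [mh' _ _] := Eh'.
have [w' w'0 Pw'] := evariable_dominated Eh'.
have Ph_w' : quasi_surely P (fun x => (h x <= (1 + lincomb g w' x)%:E)%E).
  apply: quasi_surely_impl2 Phh' Pw' _ _; first exact: measurable_not_lee.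
  by move=> x; exact: le_trans.
have Pww' : quasi_surely P (fun x => lincomb g w x = lincomb g w' x).
  apply: maxcone; [exact: cone_lincomb|exact: cone_lincomb|].
  apply: quasi_surely_impl2 Pw Ph_w' _ _; first exact: measurable_not_le.
  by move=> x ->; rewrite lee_fin lerD2l.
have Ph'h : quasi_surely P (fun x => (h' x <= (1 + lincomb g w x)%:E)%E).
  apply: quasi_surely_impl2 Pw' Pww' _ _; first exact: measurable_not_lee.
  by move=> x + ->.
have Ph'h2 : quasi_surely P (fun x => (h' x <= h x)%E).
  apply: quasi_surely_impl2 Ph'h Pw _ _; first exact: measurable_not_lee.
  by move=> x + ->.
apply: quasi_surely_impl2 Phh' Ph'h2 _ _; first exact: measurable_not_eqe.
by move=> x le1 le2; apply/eqP; rewrite eq_le le1 le2.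
Qed.

End evariables.

Theorem theorem3p10 (R : realType) (disp : measure_display)
    (T : measurableType disp) (d : nat) (d_gt0 : (0 < d)%N)
    (g : 'I_d -> T -> R) (g_meas : forall i, measurable_fun [set: T] (g i))
    (nu : {measure set T -> \bar R}) :
  let Phi : set (T -> R) := range g in
  let Phinu : set (T -> R) := with_null_indicators Phi nu in
  let Pnu : set (probability T R) := dominated_part (hypothesis Phi) nu in
  let W : set 'rV[R]_d := [set w | nonneg_orthant w /\
    quasi_surely Pnu (fun x => 0 <= 1 + lincomb g w x)] in
  [/\ Pnu = hypothesis Phinu,
      (forall f : T -> R, Q_integrable Pnu f ->
        ((forall mu, Pnu mu -> (\int[mu]_x (f x)%:E <= 0)%E) <->
         exists2 w, nonneg_orthant w &
           quasi_surely Pnu (fun x => f x <= lincomb g w x))),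
      (forall h : T -> \bar R,
        is_evariable Pnu h <->
        [/\ measurable_fun [set: T] h, (forall x, (0 <= h x)%E) &
            exists2 w, nonneg_orthant w &
              quasi_surely Pnu (fun x => (h x <= (1 + lincomb g w x)%:E)%E)]),
      (forall h : T -> \bar R, admissible Pnu h ->
        exists2 w, W w &
          quasi_surely Pnu (fun x => h x = (1 + lincomb g w x)%:E)) &
      ((forall f f' : T -> R, cone Phinu f -> cone Phinu f' ->
          quasi_surely Pnu (fun x => f x <= f' x) ->
          quasi_surely Pnu (fun x => f x = f' x)) ->
       forall h : T -> \bar R,
         measurable_fun [set: T] h -> (forall x, (0 <= h x)%E) ->
         (exists2 w, W w &
            quasi_surely Pnu (fun x => h x = (1 + lincomb g w x)%:E)) ->
         admissible Pnu h)].
Proof.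
move=> Phi Phinu Pnu W; split.
- exact: hypothesis_null_indicators.
- exact: integral_le0P.
- exact: evariableP.
- exact: admissible_affine.
- move=> maxcone h mh h0 [w [w0 _] Pw].
  exact: affine_admissible Pw.
Qed.
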